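(* Given any fixed graphs $F$ and $G$, there is a sufficiently large integer $k$ such that every $H\in\mathcal{IIM}_k(G)$ contains $F$ as an induced subgraph.
   Context: Graphs are finite, simple, undirected and nonempty. $N(v)$ is the neighborhood of $v$ and $N[v]=\{v\}\cup N(v)$. The Iterated Independent Model (IIM): Given a graph $G'$, one time step adds to $G'$, for every vertex $v \in V(G')$, exactly one new vertex $v'$ (the copy of $v$), which is, by a choice made independently for each $v$, either a clone of $v$, meaning $N(v')=N[v]$, or an anticlone of $v$, meaning $N(v')=V(G')\setminus N[v]$; here $N[v]$ is taken in $G'$, no edges are added among old vertices, and the vertices added in the same step are pairwise non-adjacent. $\mathcal{IIM}_k(G)$ is the set of all graphs obtainable from $G$ by $k$ successive time steps (over all choices), with $\mathcal{IIM}_0(G)=\{G\}$. *)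

(* Defs.v *)
From mathcomp Require Import all_boot.
Set Implicit Arguments.
Unset Strict Implicit.
Unset Printing Implicit Defensive.

Record graph := Graph {
  vertex :> finType;
  adj : rel vertex;
  adj_sym : symmetric adj;
  adj_irrefl : irreflexive adj;
  vertex_gt0 : 0 < #|vertex|
}.
Arguments adj {g} u v : rename.

Definition nbhd (G : graph) (v : G) : {set G} := [set u | adj v u].

Definition closed_nbhd (G : graph) (v : G) : {set G} := v |: nbhd v.

Section Step.
Variables (G : graph) (C : {set G}).

(* The neighbourhood of the copy of v: v is cloned if v \in C, and anticloned
   otherwise. *)
Definition copy_nbhd (v : G) : {set G} :=
  if v \in C then closed_nbhd v else ~: closed_nbhd v.

(* inl v is the old vertex v, inr v is its copy. *)
Definition iim_adj : rel (G + G) := fun x y =>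
  match x, y with
  | inl u, inl v => adj u v
  | inl u, inr v => u \in copy_nbhd v
  | inr u, inl v => v \in copy_nbhd u
  | inr _, inr _ => false
  end.

Lemma iim_adj_sym : symmetric iim_adj.
Proof. by case=> u [] v //=; rewrite adj_sym. Qed.

Lemma iim_adj_irrefl : irreflexive iim_adj.
Proof. by case=> u //=; rewrite adj_irrefl. Qed.

Lemma iim_vertex_gt0 : 0 < #|{: G + G}|.
Proof. by rewrite card_sum addn_gt0 vertex_gt0. Qed.

Definition iim_step : graph := Graph iim_adj_sym iim_adj_irrefl iim_vertex_gt0.

End Step.

Fixpoint IIM (k : nat) (G H : graph) : Prop :=
  match k with
  | 0 => H = G
  | k'.+1 => exists (G' : graph) (C : {set G'}), IIM k' G G' /\ H = iim_step C
  end.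

Definition induced_subgraph (F H : graph) : Prop :=
  exists f : F -> H, injective f /\ forall u v : F, adj (f u) (f v) = adj u v.

(* Main.v *)
Require Import Defs.
From Stdlib Require Import Classical_Prop.
From mathcomp Require Import all_boot zify.

(** Fix a vertex of [G] and encode its descendants after [k] steps by the words
    of length [k] over [bool] that say at which steps one passes to the copy.
    Give each word the parity [par] of the number of anticlonings on its
    history, and switch the adjacency by this parity: [sadj] is the sum of [adj]
    and of the two parities.  Then [sadj] is [true] when a vertex and its copy
    separate, is not affected when just one of two vertices is replaced by its
    copy, and becomes the sum of the two new parities when both are replaced.
    So start with [#|F|] words that are never copied simultaneously ([sadj] is
    [true] on them), copy the two ends of each nonedge of [F] at a common step
    with equal resulting parities, and finally copy the vertices one by one so
    as to give them all the same parity.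

    This can be done unless, throughout a long window, the parity obtained by
    copying a descendant of some word depends on the step only.  Then any two
    descendants of that word copied simultaneously agree; their parities can be
    equalized at the end unless copying gives a constant parity on a long
    window, in which case there is nothing to arrange. *)

Set Implicit Arguments.
Unset Strict Implicit.
Unset Printing Implicit Defensive.

(** * Words, parities and the switched adjacency *)

Section Words.

(* Words list the most recent step first; [lab p] is the parity of the copy made
   of the vertex [p], that is of the word [true :: p]. *)
Variable lab : seq bool -> bool.

Fixpoint par (w : seq bool) : bool :=
  if w is b :: p then (if b then lab p else par p) else false.

Fixpoint sadj (w1 w2 : seq bool) : bool :=
  match w1, w2 with
  | b1 :: p1, b2 :: p2 =>
      if b1 && b2 then lab p1 (+) lab p2
      else (p1 == p2) || sadj p1 p2
  | _, _ => true
  end.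

Notation wait m := (nseq m false).

Lemma sadj_sym : symmetric sadj.
Proof.
elim=> [|b p IH] [|b' p'] //=.
by rewrite andbC addbC eq_sym IH.
Qed.

Lemma cat_neq (T : eqType) (q q' x y : seq T) :
  size q = size q' -> x != y -> q ++ x != q' ++ y.
Proof. by move=> sz xy; rewrite eqseq_cat // negb_and xy orbT. Qed.

(** Since one side only waits, no step copies both; since [x != y], the equality test never
    fires. *)
Lemma sadj_wait q x y :
  x != y -> sadj (q ++ x) (wait (size q) ++ y) = sadj x y.
Proof.
move=> xy; elim: q => //= b q IH.
by rewrite andbF IH (negPf (cat_neq _ xy)) ?size_nseq.
Qed.

Lemma sadj_wait2 m x y :
  x != y -> sadj (wait m ++ x) (wait m ++ y) = sadj x y.
Proof. by move=> xy; rewrite -{2}(size_nseq m false) sadj_wait. Qed.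

Lemma par_wait m x : par (wait m ++ x) = par x.
Proof. by elim: m. Qed.

(** * Steering a family of descendants of a common word *)

Variable V : finType.
Implicit Types (g : V -> seq bool) (p x : seq bool).

Definition placed p s g :=
  [/\ injective g, forall u, size (g u) = size p + s & forall u, suffix p (g u)].

Definition move q u g : V -> seq bool :=
  fun v => (if v == u then q else wait (size q)) ++ g v.

Lemma placed_cat p s m (h : V -> seq bool) g :
  (forall u, size (h u) = m) -> placed p s g ->
  placed p (s + m) (fun u => h u ++ g u).
Proof.
move=> szh [inj sz suf]; split=> [u v /eqP|u|u].
- rewrite eqseq_cat ?szh // => /andP[_ /eqP]; exact: inj.
- by rewrite size_cat szh sz addnC addnA.
- exact: suffix_trans (suf u) (suffix_suffix _ _).
Qed.

Lemma placed_neq p s g u v : placed p s g -> u != v -> g u != g v.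
Proof. by case=> inj _ _; apply: contraNN => /eqP/inj->. Qed.

Lemma placed_move p s q u g :
  placed p s g -> placed p (s + size q) (move q u g).
Proof. by apply: placed_cat => v; case: ifP; rewrite ?size_nseq. Qed.

Lemma placed_wait p s m g :
  placed p s g -> placed p (s + m) (fun u => wait m ++ g u).
Proof. by apply: placed_cat => v; rewrite size_nseq. Qed.

Lemma sadj_move p s q u g v w :
  placed p s g -> v != w -> sadj (move q u g v) (move q u g w) = sadj (g v) (g w).
Proof.
move=> pl vw; have gvw := placed_neq pl vw.
rewrite /move; case: (eqVneq v u) vw gvw => [->|_] vw gvw.
  by rewrite eq_sym (negPf vw) sadj_wait.
case: eqVneq => _; last by rewrite sadj_wait2.
by rewrite sadj_sym sadj_wait 1?eq_sym // sadj_sym.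
Qed.

(** One-hot codes: each vertex is copied only at the step given by its rank, so no two are copied
    together. *)
Lemma placed_start p : exists2 g, placed p #|V| g &
  forall u v, u != v -> sadj (g u) (g v).
Proof.
pose g (u : V) := mkseq (pred1 (enum_rank u : nat)) #|V| ++ p.
have inj : injective g.
  move=> u v /eqP; rewrite eqseq_cat ?size_mkseq // eqxx andbT => /eqP eq_uv.
  have := congr1 (fun s => nth false s (enum_rank u)) eq_uv.
  by rewrite !nth_mkseq //= eqxx => /esym/eqP/ord_inj/enum_rank_inj.
exists g.
  split=> // u; first by rewrite size_cat size_mkseq addnC.
  exact: suffix_suffix.
move=> u v uv.
(* The disjunction survives the induction, which starts from the common word [p]. *)
suff: (g u == g v) || sadj (g u) (g v) by rewrite (inj_eq inj) (negPf uv).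
have ruv : (enum_rank u : nat) != enum_rank v.
  by apply: contraNN uv => /eqP/ord_inj/enum_rank_inj->.
rewrite /g /mkseq; elim: (iota _ _) => [|i l /= ->]; first by rewrite eqxx.
case: (i =P enum_rank u :> nat) => [->|_] /=; last by rewrite orbT.
by rewrite (negPf ruv) orbT.
Qed.

(** Each pair gets a block of [L] steps: its first end moves along [q] until the labels agree, then
    both ends are copied at once, which makes [sadj] false; the rest of the block is waiting. *)
Lemma separate_pairs p L N s g (l : seq (V * V)) :
  (forall x y, suffix p x -> suffix p y -> size x = size y ->
     size x + L <= size p + N ->
     exists2 q, size q < L & lab (q ++ x) = lab (wait (size q) ++ y)) ->
  s + L * size l <= N -> all (fun uv => uv.1 != uv.2) l -> placed p s g ->
  exists2 g', placed p (s + L * size l) g' &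
    forall u v, u != v ->
      sadj (g' u) (g' v) =
      [&& sadj (g u) (g v), (u, v) \notin l & (v, u) \notin l].
Proof.
move=> agree; elim: l s g => [|[a b] l IH] s g /= sN.
  by move=> _ pl; exists g; rewrite ?muln0 ?addn0 // => u v _; rewrite andbT.
rewrite mulnS in sN *; case/andP=> ab lP pl; have [_ sz suf] := pl.
have [||q qL eq_lab] := agree (g a) (g b) (suf a) (suf b).
- by rewrite !sz.
- by rewrite sz; lia.
pose d u := (u == a) || (u == b).
pose g1 u := [:: d u] ++ move q a g u.
pose g2 u := wait (L - (size q).+1) ++ g1 u.
have pl0 := placed_move q a pl.
have pl1 : placed p (s + size q + 1) g1 by apply: placed_cat pl0.
have pl2 : placed p (s + L) g2.
  by have := placed_wait (L - (size q).+1) pl1; congr placed; lia.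
have [|g' pl' g'E] := IH _ _ _ lP pl2; first by lia.
exists g'; first by rewrite addnA.
move=> u v uv; rewrite g'E // /g2 sadj_wait2; last exact: placed_neq pl1 uv.
rewrite !inE !negb_or -!andbA /= (negPf (placed_neq pl0 uv)) /=.
have -> : (if d u && d v then lab (move q a g u) (+) lab (move q a g v)
           else sadj (move q a g u) (move q a g v)) =
          [&& sadj (g u) (g v), (u, v) != (a, b) & (v, u) != (a, b)].
  rewrite (sadj_move _ _ pl uv) /d !xpair_eqE /move.
  move: uv; case: (eqVneq u a) => [->|_]; case: (eqVneq v a) => [->|_];
    rewrite ?eqxx ?(negPf ab) ?andbT ?andbF //=.
  - case: (eqVneq v b) => [->|_] _; rewrite ?andbT //= eq_lab addbb andbF //.
  - case: (eqVneq u b) => [->|_] _; rewrite ?andbT //= eq_lab addbb andbF //.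
  - by case: (eqVneq u b) => [->|_]; case: (eqVneq v b) => [->|_];
      rewrite ?eqxx ?andbT.
by rewrite -!andbA; do 2 congr (_ && _); rewrite andbCA.
Qed.

(** A copy overwrites the parity of its word by the label, and a copy made alone leaves [sadj]
    unchanged. *)
Lemma equalize_par p c L N s g (l : seq V) :
  (forall x, suffix p x -> size x + L <= size p + N ->
     exists2 q, size q < L & lab (q ++ x) = c) ->
  s + L * size l <= N -> placed p s g ->
  exists2 g', placed p (s + L * size l) g' &
    (forall u v, u != v -> sadj (g' u) (g' v) = sadj (g u) (g v)) /\
    (forall u, par (g' u) = if u \in l then c else par (g u)).
Proof.
move=> hit; elim: l s g => [|a l IH] s g /= sN pl.
  by exists g; rewrite ?muln0 ?addn0.
rewrite mulnS in sN *; have [_ sz suf] := pl.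
have [|q qL labc] := hit (g a) (suf a); first by rewrite sz; lia.
pose q' := wait (L - (size q).+1) ++ true :: q.
have szq : size q' = L by rewrite size_cat size_nseq /=; lia.
have [||g' pl' [sE pE]] := IH (s + L) (move q' a g); first by lia.
  by rewrite -[in s + L]szq; apply: placed_move.
exists g'; first by rewrite addnA.
split=> [u v uv|u]; first by rewrite sE // (sadj_move _ _ pl).
rewrite pE inE /move; case: (u \in l); rewrite ?orbT // orbF.
by case: eqP => [->|_]; rewrite ?par_wait // -catA par_wait /=.
Qed.

End Words.

(** * Embedding [F] under an arbitrary labelling *)

Definition embeds lab k (F : graph) :=
  exists g : F -> seq bool, [/\ injective g, forall u, size (g u) = k &
    forall u v, u != v ->
      adj u v = sadj lab (g u) (g v) (+) par lab (g u) (+) par lab (g v)].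

Lemma embeds_wait lab k m F : embeds lab k F -> embeds lab (m + k) F.
Proof.
move=> [g [inj sz gE]]; exists (fun u => nseq m false ++ g u); split.
- by move=> u v /eqP; rewrite eqseq_cat // eqxx => /eqP/inj.
- by move=> u; rewrite size_cat size_nseq sz.
- by move=> u v uv; rewrite !par_wait sadj_wait2 ?(inj_eq inj) // gE.
Qed.

Definition nonedges (F : graph) : seq (F * F) :=
  [seq uv <- enum {: F * F} | (uv.1 != uv.2) && ~~ adj uv.1 uv.2].

Lemma mem_nonedges (F : graph) (u v : F) :
  ((u, v) \in nonedges F) = (u != v) && ~~ adj u v.
Proof. by rewrite mem_filter (mem_enum predT) andbT. Qed.

(** The summands of [N] pay for the initial placement, a block per ordered nonedge and a block per
    vertex. In the end all parities equal [c] and cancel. *)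
Lemma embeds_reachable lab p c L1 L2 (F : graph) :
  let N := #|F| + L1 * size (nonedges F) + L2 * #|F| in
  (forall x y, suffix p x -> suffix p y -> size x = size y ->
     size x + L1 <= size p + N ->
     exists2 q, size q < L1 & lab (q ++ x) = lab (nseq (size q) false ++ y)) ->
  (forall x, suffix p x -> size x + L2 <= size p + N ->
     exists2 q, size q < L2 & lab (q ++ x) = c) ->
  embeds lab (size p + N) F.
Proof.
move=> N agree hit.
have [g0 pl0 g0E] := placed_start lab F p.
have [||g1 pl1 g1E] := separate_pairs (l := nonedges F) agree _ _ pl0.
- by rewrite /N; lia.
- by apply/allP=> uv; rewrite mem_filter => /andP[/andP[]].
have [|g2 [inj sz _] [sE pE]] := equalize_par (l := enum F) hit _ pl1.
  by rewrite -cardE leqnn.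
exists g2; split=> [||u v uv] //; first by move=> u; rewrite sz -cardE /N.
rewrite !pE !mem_enum /= -addbA addbb addbF sE // g1E // g0E //.
rewrite !mem_nonedges [v == u]eq_sym uv [adj v u]adj_sym.
by rewrite !negbK andbb.
Qed.

(* The costs [N] of [embeds_reachable] for [L1], [L2] equal to 1, 1 ([window]),
   to 1, [window F] ([long_window]) and to [long_window F], [window F] ([depth]). *)
Definition window (F : graph) := #|F| + size (nonedges F) + #|F|.

Definition long_window (F : graph) :=
  #|F| + size (nonedges F) + window F * #|F|.

Definition depth (F : graph) :=
  #|F| + long_window F * size (nonedges F) + window F * #|F|.

Lemma embeds_constant lab p c F :
  (forall q, size q < window F -> lab (q ++ p) = c) ->
  embeds lab (size p + window F) F.
Proof.
move=> cst.
have cst1 x : suffix p x -> size x + 1 <= size p + window F -> lab x = c.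
  move=> /suffixP[q ->]; rewrite size_cat addn1 [size q + _]addnC ltn_add2l.
  exact: cst.
have := @embeds_reachable lab p c 1 1 F; rewrite !mul1n; apply.
  move=> x y px py szxy szx; exists [::] => //=.
  by rewrite !cst1 -?szxy.
by move=> x px szx; exists [::] => //; apply: cst1.
Qed.

Lemma embeds_level_uniform lab p (f : nat -> bool) c F :
  (forall q, size q < long_window F -> lab (q ++ p) = f (size q)) ->
  (forall x, suffix p x -> size x + window F <= size p + long_window F ->
     exists2 q, size q < window F & lab (q ++ x) = c) ->
  embeds lab (size p + long_window F) F.
Proof.
move=> unif hit.
have := @embeds_reachable lab p c 1 (window F) F; rewrite mul1n; apply=> //.
move=> _ _ /suffixP[q ->] /suffixP[q' ->]; rewrite !size_cat => /addIn szq.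
rewrite addn1 [size q + _]addnC ltn_add2l => qL.
by exists [::] => //=; rewrite !unif -?szq.
Qed.

Lemma embeds_depth lab F : embeds lab (depth F) F.
Proof.
have shift k : k <= depth F -> embeds lab k F -> embeds lab (depth F) F.
  by move=> kD /(embeds_wait (depth F - k)); rewrite subnK.
have [[p [c [pD cst]]]|noconst] := classic (exists p c,
    size p + window F <= depth F /\
    forall q, size q < window F -> lab (q ++ p) = c).
  exact: shift (embeds_constant cst).
have hit x : size x + window F <= depth F ->
    exists2 q, size q < window F & lab (q ++ x) = true.
  move=> xD; apply: NNPP => none; apply: noconst; exists x, false.
  split=> // q qW.
  by apply/negbTE/negP => labq; apply: none; exists q.
have [[x [y [xD neq]]]|agree] := classic (exists x y,
    size x + long_window F <= depth F /\ forall q, size q < long_window F ->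
      lab (q ++ x) <> lab (nseq (size q) false ++ y)).
  apply: (shift _ xD).
  (* Labels that always differ from those along the waiting [y] are their negations, hence depend on
     the length of [q] only. *)
  apply: (@embeds_level_uniform _ _ (fun i => ~~ lab (nseq i false ++ y)) true).
    by move=> q /neq/eqP; case: (lab _); case: (lab _).
  by move=> z _ zL; apply: hit; apply: leq_trans xD.
apply: (@embeds_reachable lab [::] true) => [x y _ _ _ xD|x _]; last exact: hit.
apply: NNPP => none; apply: agree; exists x, y; split=> // q qL labq.
by apply: none; exists q.
Qed.

(** * Reading the model as a labelling of words *)

Lemma par_ext lab lab' w :
  (forall p, size p < size w -> lab p = lab' p) -> par lab w = par lab' w.
Proof.
elim: w => //= b p IH eq_lab; rewrite eq_lab //.
by rewrite IH // => q qp; apply: eq_lab; apply: ltnW.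
Qed.

Lemma sadj_ext lab lab' k w w' :
  (forall p, size p < k -> lab p = lab' p) -> size w = k -> size w' = k ->
  sadj lab w w' = sadj lab' w w'.
Proof.
move=> eq_lab.
elim: k w w' eq_lab => [|k IH] [|b p] [|b' p'] //= eq_lab [sp] [sp'].
by rewrite !eq_lab ?sp ?sp' // (IH p p') // => q qk; apply: eq_lab; apply: ltnW.
Qed.

Lemma IIM_words k (G H : graph) : IIM k G H ->
  exists lab (phi : seq bool -> H),
    forall w w', size w = k -> size w' = k -> w != w' ->
    phi w != phi w' /\
    adj (phi w) (phi w') = sadj lab w w' (+) par lab w (+) par lab w'.
Proof.
elim: k H => [|k IH] H /=.
  move=> ->; have /card_gt0P[v _] := vertex_gt0 G.
  (* There is only one word of length 0, so the claim is vacuous. *)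
  by exists xpred0, (fun=> v) => -[|? ?] [|? ?].
move=> [G' [C [/IH[lab [phi phiE]] ->]]].
(* An anticlone flips the parity of its original, a clone keeps it. Shorter words retain their
   labels, so [par] and [sadj] persist at length [k]. *)
pose lab' p := if size p == k then par lab p (+) (phi p \notin C) else lab p.
pose phi' w : iim_step C := if w is b :: p then
  (if b then inr (phi p) else inl (phi p)) else inl (phi [::]).
have eq_lab p : size p < k -> lab' p = lab p.
  by rewrite /lab' ltn_neqAle => /andP[/negPf->].
exists lab', phi' => -[|b p] [|b' p'] //= [sp] [sp'] ww'.
have parE q : size q = k -> par lab' q = par lab q.
  by move=> sq; apply: par_ext => r; rewrite sq; apply: eq_lab.
have labE q : size q = k -> lab' q = par lab q (+) (phi q \notin C).
  by move=> sq; rewrite /lab' sq eqxx.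
rewrite !labE // !parE // (sadj_ext eq_lab sp sp').
have copyE q q' : size q = k -> size q' = k ->
    (phi q \in copy_nbhd C (phi q')) =
    ((q == q') || sadj lab q q') (+) par lab q (+)
    (par lab q' (+) (phi q' \notin C)).
  move=> sq sq'; rewrite /copy_nbhd /closed_nbhd.
  (* Anticloning complements the closed neighbourhood, that is, adds one bit. *)
  have -> : (phi q \in if phi q' \in C then phi q' |: nbhd (phi q')
              else ~: (phi q' |: nbhd (phi q'))) =
            ((phi q == phi q') || adj (phi q) (phi q')) (+) (phi q' \notin C).
    by rewrite adj_sym; case: ifP => _; rewrite !inE ?addbF ?addbT.
  case: (eqVneq q q') => [->|qq']; first by rewrite eqxx /=; case: (par _ _).
  by have [/negPf-> ->] := phiE _ _ sq sq' qq'; rewrite -!addbA.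
have [pp'|pp'] := eqVneq p p'.
  move: ww'; rewrite -pp'; case: b; case: b'; rewrite ?eqxx //= => _.
    by split=> //; rewrite copyE // eqxx /=; case: (par _ _); case: (_ \notin _).
  by split=> //; rewrite copyE // eqxx /=.
have [neq adjE] := phiE _ _ sp sp' pp'.
case: b {ww'}; case: b' => /=; split=> //.
- by rewrite -addbA addbb.
- rewrite copyE // eq_sym (negPf pp') sadj_sym /= -!addbA.
  by congr addb; rewrite addbC -addbA.
- by rewrite copyE // (negPf pp').
Qed.

Theorem theorem5p2 (F G : graph) :
  exists k : nat, forall H : graph, IIM k G H -> induced_subgraph F H.
Proof.
exists (depth F) => H /IIM_words[lab [phi phiE]].
have [g [inj sz gE]] := embeds_depth lab F.
have {}phiE u v : u != v ->
    phi (g u) != phi (g v) /\ adj (phi (g u)) (phi (g v)) = adj u v.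
  by move=> uv; rewrite gE //; apply: phiE; rewrite ?(inj_eq inj).
exists (phi \o g); split=> [u v /= /eqP|u v /=].
  by apply: contraTeq => /phiE[].
by have [->|/phiE[_ ->]] := eqVneq u v; rewrite ?adj_irrefl.
Qed.
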